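(* Let $\alpha\in[0,1]$. Then $\|\cdot\|_{A_\alpha}$ defines a semi-norm on $\mathcal{B}_{A^{1/2}}(\mathcal{H})$. This semi-norm is equivalent to the $A$-numerical radius $w_A$ and to the $A$-operator semi-norm $\|\cdot\|_A$, and the following inequalities hold for every $T\in\mathcal{B}_{A^{1/2}}(\mathcal{H})$: (i) $w_{A}(T) \leq \|T\|_{A_\alpha} \leq \sqrt{4-3\alpha}\; w_{A}(T)$; (ii) $\max\left\{\frac{1}{2},\sqrt{1-\alpha}\right\}\|T\|_{A} \leq \|T\|_{A_\alpha} \leq \|T\|_{A}$.
   Context: $\mathcal{H}$ is a complex Hilbert space with inner product $\langle\cdot,\cdot\rangle$, $\mathcal{B}(\mathcal{H})$ is the algebra of bounded linear operators on $\mathcal{H}$, and $A\in\mathcal{B}(\mathcal{H})$ is a fixed positive operator (self-adjoint with $\langle Ax,x\rangle\ge 0$ for all $x\in\mathcal{H}$). Put $\langle x,y\rangle_A=\langle Ax,y\rangle$ and $\|x\|_A=\sqrt{\langle x,x\rangle_A}=\|A^{1/2}x\|$. Let $\mathcal{B}_{A^{1/2}}(\mathcal{H})=\{T\in\mathcal{B}(\mathcal{H}) : \exists\, c>0 \text{ with } \|Tx\|_A\le c\|x\|_A\ \forall x\in\mathcal{H}\}$. For $T\in\mathcal{B}_{A^{1/2}}(\mathcal{H})$: - the $A$-operator semi-norm is $\|T\|_A=\sup\{\|Tx\|_A/\|x\|_A : x\in\overline{R(A)},\ x\ne 0\}$, where $\overline{R(A)}$ is the closure of the range of $A$; - the $A$-numerical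 radius is $w_A(T)=\sup\{|\langle Tx,x\rangle_A| : x\in\mathcal{H},\ \|x\|_A=1\}$; - for $\alpha\in[0,1]$, $\|T\|_{A_\alpha}=\sup\left\{\sqrt{\alpha|\langle Tx,x\rangle_A|^2+(1-\alpha)\|Tx\|_A^2} : x\in\mathcal{H},\ \|x\|_A=1\right\}$. *)

(* Defs.v *)
From HB Require Import structures.
From mathcomp Require Import all_boot all_order all_algebra.
From mathcomp Require Import sesquilinear complex.
From mathcomp Require Import all_classical all_reals all_analysis.

Set Implicit Arguments.
Unset Strict Implicit.
Unset Printing Implicit Defensive.

Import Order.TTheory GRing.Theory Num.Theory.
Import numFieldNormedType.Exports.

Local Open Scope classical_set_scope.
Local Open Scope ring_scope.

Section Seminorms.
Context {R : realType} {E : lmodType R[i]}.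
Implicit Types (V : set E) (p q : E -> R).

(* The order and the norm of [R[i]] take values in [R[i]]; the norm is always
   real, so its real part is the usual modulus. *)
Definition modulus (z : R[i]) : R := complex.Re `|z|.

Definition is_subspace V : Prop :=
  V 0 /\ forall (a : R[i]) (x y : E), V x -> V y -> V (a *: x + y).

Definition is_seminorm_on V p : Prop :=
  [/\ is_subspace V,
      forall x, V x -> 0 <= p x,
      forall (a : R[i]) x, V x -> p (a *: x) = modulus a * p x &
      forall x y, V x -> V y -> p (x + y) <= p x + p y].

Definition equivalent_on V p q : Prop :=
  exists c C : R, [/\ 0 < c, 0 < C &
    forall x, V x -> c * p x <= q x /\ q x <= C * p x].

End Seminorms.

Section SemiHilbert.
Context {R : realType} {H : completeNormedModType R[i]}.
Variable dot : {dot H for Num.conj}.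

(* With completeness of [H], this makes [H] a complex Hilbert space; [dot] is
   linear in its first argument and conjugate-linear in its second. *)
Definition dot_induces_norm : Prop := forall x : H, `|x| ^+ 2 = dot x x.

Definition bounded_operator (T : H -> H) : Prop :=
  linear T /\ exists M : R[i], forall x, `|T x| <= M * `|x|.

(* An inequality [0 <= z] in [R[i]] says that [z] is real and nonnegative. *)
Definition positive_operator (A : H -> H) : Prop :=
  [/\ bounded_operator A,
      forall x y, dot (A x) y = dot x (A y) &
      forall x, 0 <= dot (A x) x].

Variable A : H -> H.

Definition dotA (x y : H) : R[i] := dot (A x) y.

Definition normA (x : H) : R := Num.sqrt (complex.Re (dotA x x)).

Definition BAhalf : set (H -> H) :=
  [set T | bounded_operator T /\
           exists2 c : R, 0 < c & forall x, normA (T x) <= c * normA x].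

(* The suprema below are real suprema, with [sup set0 = 0]. This convention is
   only used when [A = 0], the one case in which the index sets are empty. *)
Definition opnormA_values (T : H -> H) : set R :=
  [set normA (T x) / normA x | x in [set x | closure (range A) x /\ x != 0]].

Definition opnormA (T : H -> H) : R := sup (opnormA_values T).

Definition numradA_values (T : H -> H) : set R :=
  [set modulus (dotA (T x) x) | x in [set x | normA x = 1]].

Definition numradA (T : H -> H) : R := sup (numradA_values T).

Definition normAalpha_values (alpha : R) (T : H -> H) : set R :=
  [set Num.sqrt (alpha * modulus (dotA (T x) x) ^+ 2
                 + (1 - alpha) * normA (T x) ^+ 2) | x in [set x | normA x = 1]].

Definition normAalpha (alpha : R) (T : H -> H) : R :=
  sup (normAalpha_values alpha T).

End SemiHilbert.

(* Main.v *)
(* The polarization identity and the parallelogram law for the semi-inner product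
   <Ax, y> give |<Tx, y>_A| <= 2 w_A(T) for unit x and y; with y proportional to
   Tx this is ||Tx||_A <= 2 w_A(T).  For unit x,
     |<Tx, x>_A| <= sqrt(alpha |<Tx, x>_A|^2 + (1 - alpha) ||Tx||_A^2) <= ||Tx||_A
   by Cauchy-Schwarz, and all the inequalities follow by taking suprema.
   The supremum in ||T||_A runs over the closure of R(A) only.  No orthogonal
   projection is needed to compare it with the other two: the gradient iteration
   w |-> w - Aw / M started at x stays in x + R(A) and drives ||w||_A to 0, so
   R(A) is dense for the semi-norm ||.||_A. *)
Require Import Defs.
From mathcomp Require Import all_boot all_order all_algebra.
From mathcomp Require Import sesquilinear complex.
From mathcomp Require Import all_classical all_reals all_analysis.
From mathcomp Require Import ring lra.
Import Order.TTheory GRing.Theory Num.Theory.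
Import numFieldNormedType.Exports.
Local Open Scope classical_set_scope.
Local Open Scope ring_scope.

(** * Real-valued modulus of complex numbers *)

Section Modulus.
Set Implicit Arguments.
Unset Strict Implicit.
Context {R : realType}.
Implicit Types (z w : R[i]) (t : R).

Lemma modulusE z : ((modulus z)%:C)%C = `|z|.
Proof. by rewrite /modulus RRe_real ?normr_real. Qed.

Lemma modulus_ge0 z : 0 <= modulus z.
Proof. by rewrite -ler0c modulusE. Qed.

Lemma modulusM z w : modulus (z * w) = modulus z * modulus w.
Proof. by apply: complexI; rewrite rmorphM /= !modulusE normrM. Qed.

Lemma le_modulusD z w : modulus (z + w) <= modulus z + modulus w.
Proof. by rewrite -lecR rmorphD /= !modulusE ler_normD. Qed.

Lemma modulus_norm z w : `|z| = `|w| -> modulus z = modulus w.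
Proof. by rewrite /modulus => ->. Qed.

Lemma modulus_real t : 0 <= t -> modulus (t%:C)%C = t.
Proof. by move=> t0; apply: complexI; rewrite modulusE ger0_norm ?ler0c. Qed.

End Modulus.

(** * Semi-inner products: Cauchy-Schwarz, triangle inequality, parallelogram law *)

Section SemiInnerProduct.
Set Implicit Arguments.
Unset Strict Implicit.
Context {R : realType} {E : lmodType R[i]}.
Variable q : E -> E -> R[i].

(** Kept abstract in [q] so that it covers both [dot] and [dotA]; [normA dot A] is convertible to
    its instance at [dotA dot A]. *)
Definition seminormq (x : E) : R := Num.sqrt (complex.Re (q x x)).

Hypothesis q_linear : forall a x y z, q (a *: x + y) z = a * q x z + q y z.
Hypothesis q_herm : forall x y, q y x = (q x y)^*.
Hypothesis q_ge0 : forall x, 0 <= q x x.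
Local Notation N := seminormq.

Lemma formDl x y z : q (x + y) z = q x z + q y z.
Proof. by rewrite -[x]scale1r q_linear mul1r scale1r. Qed.

Lemma formDr x y z : q z (x + y) = q z x + q z y.
Proof. by rewrite !(q_herm _ z) formDl rmorphD. Qed.

Lemma form0l z : q 0 z = 0.
Proof. by apply: (@addrI _ (q 0 z)); rewrite -formDl !addr0. Qed.

Lemma formZl a x z : q (a *: x) z = a * q x z.
Proof. by rewrite -[a *: x]addr0 q_linear form0l addr0. Qed.

Lemma formZr a x z : q z (a *: x) = a^* * q z x.
Proof. by rewrite !(q_herm _ z) formZl rmorphM. Qed.

Lemma seminormq_ge0 x : 0 <= N x. Proof. exact: sqrtr_ge0. Qed.

Lemma seminormq_sq x : ((N x ^+ 2)%:C)%C = q x x.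
Proof.
have q0 := q_ge0 x.
by rewrite sqr_sqrtr ?RRe_real ?ger0_real//; move: q0; rewrite lecE => /andP[].
Qed.

Lemma seminormqD_sq x y c :
  (((N (x + c *: y)) ^+ 2)%:C)%C =
  q x x + c^* * q x y + c * (q x y)^* + c * c^* * q y y.
Proof.
rewrite seminormq_sq formDl !formDr !formZl !formZr (q_herm x y); ring.
Qed.

Lemma cauchy_schwarz x y : modulus (q x y) <= N x * N y.
Proof.
(* For real [t] this is the expansion of [N (x - t q(x, y) y) ^+ 2]; the factor [q x y] makes the
   cross term real. *)
have key t : 0 <= N x ^+ 2 - 2 * t * modulus (q x y) ^+ 2
    + t ^+ 2 * modulus (q x y) ^+ 2 * N y ^+ 2.
  suff -> : N x ^+ 2 - 2 * t * modulus (q x y) ^+ 2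
      + t ^+ 2 * modulus (q x y) ^+ 2 * N y ^+ 2
      = N (x + (- (t%:C)%C * q x y) *: y) ^+ 2 by exact: sqr_ge0.
  apply: complexI; rewrite seminormqD_sq.
  have sq z : ((N z)%:C)%C ^+ 2 = q z z by rewrite -seminormq_sq rmorphXn.
  have cs : ((modulus (q x y))%:C)%C ^+ 2 = q x y * (q x y)^*.
    by rewrite modulusE normCK.
  have real2 : ((2 : R)%:C)%C = 2 :> R[i] by rewrite rmorph_nat.
  have realt : ((- (t%:C)%C : R[i])^* = - (t%:C)%C).
    by rewrite rmorphN /=; congr (- _); exact: conjc_real.
  rewrite [(_ * q x y)^*]rmorphM /= realt -!sq.
  transitivity (((N x)%:C)%C ^+ 2 - 2 * (t%:C)%C * ((modulus (q x y))%:C)%C ^+ 2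
    + (t%:C)%C ^+ 2 * ((modulus (q x y))%:C)%C ^+ 2 * ((N y)%:C)%C ^+ 2).
    by ring.
  by rewrite cs; ring.
have [m0 p0 r0] : [/\ 0 <= modulus (q x y), 0 <= N x & 0 <= N y].
  by rewrite modulus_ge0 !seminormq_ge0.
rewrite -(@ler_pXn2r _ 2%N) ?nnegrE ?mulr_ge0// exprMn.
move: (key); set m := modulus _ ^+ 2; set r := N y ^+ 2; set p := N x ^+ 2.
move=> {}key.
have : 0 <= r by exact: sqr_ge0.
rewrite le_eqVlt => /predU1P[r_eq0|r_gt0].
  (* The form may be degenerate. If [N y = 0], [key] is affine in [t], and this choice of [t] gives
     it the value -1. *)
  rewrite -r_eq0 mulr0 leNgt; apply/negP => m_gt0.
  have := key ((p + 1) / (2 * m)); rewrite -r_eq0 mulr0 addr0.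
  have -> : 2 * ((p + 1) / (2 * m)) * m = p + 1 by field; rewrite gt_eqF.
  by rewrite opprD addNKr oppr_ge0 ler10.
(* The quadratic in [t] is minimal at [1 / r]. *)
have := key r^-1.
have -> : p - 2 / r * m + r^-1 ^+ 2 * m * r = (p * r - m) / r by field; rewrite gt_eqF.
by rewrite pmulr_lge0 ?invr_gt0// subr_ge0.
Qed.

Lemma seminormqZ a x : N (a *: x) = modulus a * N x.
Proof.
apply: (@pexpIrn _ 2%N); rewrite ?nnegrE ?mulr_ge0 ?modulus_ge0 ?seminormq_ge0//.
apply: complexI; rewrite exprMn [RHS]rmorphM /= !seminormq_sq rmorphXn /= modulusE.
by rewrite normCK formZl formZr mulrA.
Qed.

Lemma seminormqD x y : N (x + y) <= N x + N y.
Proof.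
rewrite -(@ler_pXn2r _ 2%N) ?nnegrE ?addr_ge0 ?seminormq_ge0//.
rewrite -lecR -{1}[y]scale1r seminormqD_sq sqrrD !rmorphD /= !seminormq_sq.
rewrite rmorph1 !mul1r lerD2r -addrA lerD2l.
have := cauchy_schwarz x y; rewrite -lecR modulusE => cs.
apply: le_trans (_ : `|q x y| + `|q x y| <= _); last first.
  by apply: lerD.
have -> : q x y + (q x y)^* = 'Re (q x y) + 'Re (q x y).
  by rewrite ReE; field.
by apply: lerD; rewrite leif_Re_Creal.
Qed.


Lemma seminormqE x y c :
  N (x + c *: y) ^+ 2 = N x ^+ 2 + 2 * complex.Re (c^* * q x y)
                        + modulus c ^+ 2 * N y ^+ 2.
Proof.
have cJ : c * (q x y)^* = (c^* * q x y)^* by rewrite rmorphM /= conjCK.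
have two z : z + z^* = ((2 * complex.Re z)%:C)%C.
  by rewrite [LHS]addcJ [RHS]rmorphM /= [(2%:C)%C]rmorph_nat.
apply: complexI; rewrite seminormqD_sq // cJ -addrA -addrA -normCK -modulusE.
rewrite (addrA (c^* * _)) two -!seminormq_sq // -[((modulus c)%:C)%C ^+ 2]rmorphXn.
rewrite -[((modulus c ^+ 2)%:C)%C * _]rmorphM.
by rewrite -!rmorphD addrA.
Qed.

Lemma seminormq_parallelogram x y :
  N (x + y) ^+ 2 + N (x - y) ^+ 2 = 2 * (N x ^+ 2 + N y ^+ 2).
Proof.
have -> : x - y = x + (-1) *: y by rewrite scaleN1r.
rewrite -{1}[y]scale1r !seminormqE.
have -> : modulus (-1 : R[i]) = 1 by apply: complexI; rewrite modulusE normrN1.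
have -> : modulus (1 : R[i]) = 1 by apply: complexI; rewrite modulusE normr1.
by rewrite rmorphN !rmorph1 mulN1r raddfN /= mul1r; ring.
Qed.

End SemiInnerProduct.

(** * Numerical range of a linear operator and polarization *)

Section Operators.
Set Implicit Arguments.
Unset Strict Implicit.
Context {R : realType} {E : lmodType R[i]}.
Variable q : E -> E -> R[i].
Hypothesis q_linear : forall a x y z, q (a *: x + y) z = a * q x z + q y z.
Hypothesis q_herm : forall x y, q y x = (q x y)^*.
Hypothesis q_ge0 : forall x, 0 <= q x x.
Local Notation N := (seminormq q).

Lemma linear_map0 (T : E -> E) : linear T -> T 0 = 0.
Proof.
move=> Tlin; apply: (@addrI _ (T 0)).
by rewrite -{1}[T 0]scale1r -Tlin scale1r !addr0.
Qed.

Lemma linear_scale (T : E -> E) : linear T -> forall a x, T (a *: x) = a *: T x.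
Proof.
by move=> Tlin a x; rewrite -[a *: x]addr0 Tlin linear_map0 // addr0.
Qed.

Lemma linear_add (T : E -> E) : linear T -> forall x y, T (x + y) = T x + T y.
Proof. by move=> Tlin x y; rewrite -{1}[x]scale1r Tlin scale1r. Qed.

Lemma seminormq_normalize x : 0 < N x -> N (((N x)^-1)%:C%C *: x) = 1.
Proof.
move=> x0; rewrite seminormqZ // modulus_real ?invr_ge0 ?ltW//.
by rewrite mulVf ?gt_eqF.
Qed.

(** Vectors of positive semi-norm are rescaled to norm 1; for null vectors Cauchy-Schwarz makes the
    left side vanish. *)
Lemma numrange_homogeneous (T : E -> E) (c w : R) : linear T ->
  (forall x, N (T x) <= c * N x) ->
  (forall x, N x = 1 -> modulus (q (T x) x) <= w) ->
  forall x, modulus (q (T x) x) <= w * N x ^+ 2.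
Proof.
move=> Tlin Tc Tw x.
have := seminormq_ge0 q x; rewrite le_eqVlt => /predU1P[x_eq0|x_gt0].
  have := cauchy_schwarz q_linear q_herm q_ge0 (T x) x.
  by rewrite -x_eq0 expr0n /= !mulr0.
have := Tw _ (seminormq_normalize x_gt0).
rewrite linear_scale // (formZl q_linear) (formZr q_linear q_herm) !modulusM.
rewrite (modulus_norm (norm_conjC _)) modulus_real ?invr_ge0 ?(ltW x_gt0)//.
by rewrite mulrA -expr2 exprVn ler_pdivrMl ?exprn_gt0// mulrC.
Qed.

Lemma polarization (T : E -> E) x y : linear T ->
  4 * q (T x) y =
    (q (T (x + y)) (x + y) - q (T (x - y)) (x - y))
    + 'i * (q (T (x + 'i *: y)) (x + 'i *: y) - q (T (x - 'i *: y)) (x - 'i *: y)).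
Proof.
move=> Tlin; rewrite -!scaleNr.
have exp c : q (T (x + c *: y)) (x + c *: y) =
    q (T x) x + c^* * q (T x) y + c * q (T y) x + c * c^* * q (T y) y.
  rewrite linear_add // linear_scale // (formDl q_linear).
  rewrite !(formDr q_linear q_herm) !(formZl q_linear).
  by rewrite !(formZr q_linear q_herm); ring.
have -> : x + y = x + 1 *: y by rewrite scale1r.
have -> : x - y = x + (-1) *: y by rewrite scaleN1r.
rewrite !exp !rmorphN rmorph1 /= conjCi.
apply: subr0_eq.
(* The two sides differ by a multiple of ['i ^+ 2 + 1]; exhibiting it lets [ring] treat ['i] as an
   indeterminate. *)
transitivity ((('i : R[i]) ^+ 2 + 1) * (2 * q (T x) y - 2 * q (T y) x)); last first.
  by rewrite sqrCi addNr mul0r.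
by ring.
Qed.

(** Polarization bounds [4 |q (T x) y|] by four values of the quadratic form, at vectors whose
    squared norms sum to 8 by the parallelogram law. *)
Lemma numrange_bound (T : E -> E) (w : R) : linear T ->
  (forall x, modulus (q (T x) x) <= w * N x ^+ 2) ->
  forall x, N x = 1 -> N (T x) <= 2 * w.
Proof.
move=> Tlin Tw x x1.
have bound y : N y = 1 -> modulus (q (T x) y) <= 2 * w.
  move=> y1.
  have diff z : N z = 1 ->
      modulus (q (T (x + z)) (x + z) - q (T (x - z)) (x - z)) <= 4 * w.
    move=> z1; apply: le_trans (le_modulusD _ _) _.
    rewrite (modulus_norm (normrN _)).
    apply: le_trans (lerD (Tw _) (Tw _)) _.
    rewrite -mulrDr seminormq_parallelogram // x1 z1 expr1n; lra.
  have mi : modulus ('i : R[i]) = 1 by apply: complexI; rewrite modulusE normCi.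
  have iy1 : N ('i *: y) = 1 by rewrite seminormqZ // mi mul1r.
  have m4 : modulus (4 : R[i]) = 4.
    by rewrite -[4](rmorph_nat (real_complex R)) modulus_real.
  have := le_modulusD (q (T (x + y)) (x + y) - q (T (x - y)) (x - y))
    ('i * (q (T (x + 'i *: y)) (x + 'i *: y) - q (T (x - 'i *: y)) (x - 'i *: y))).
  rewrite -polarization // !modulusM mi m4 mul1r.
  have := diff _ y1; have := diff _ iy1; lra.
(* [T x] can be normalized only if its semi-norm is positive; otherwise [0 <= w] suffices, and [Tw]
   at [x] provides it. *)
have := seminormq_ge0 q (T x); rewrite le_eqVlt => /predU1P[n0|n_gt0].
  rewrite -n0; have := Tw x; rewrite x1 expr1n mulr1.
  by have := modulus_ge0 (q (T x) x); lra.
have := bound _ (seminormq_normalize n_gt0).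
rewrite (formZr q_linear q_herm) -seminormq_sq // modulusM (modulus_norm (norm_conjC _)).
rewrite !modulus_real ?sqr_ge0 ?invr_ge0 ?(ltW n_gt0)//.
by rewrite expr2 mulrA mulVf ?mul1r ?gt_eqF.
Qed.

End Operators.

(** * Density of the range of [A] for the semi-norm that [A] induces *)

Section RangeDensity.
Set Implicit Arguments.
Unset Strict Implicit.
Context {R : realType} {E : lmodType R[i]}.
Variables (q : E -> E -> R[i]) (A : E -> E) (M : R).
Hypothesis q_linear : forall a x y z, q (a *: x + y) z = a * q x z + q y z.
Hypothesis q_herm : forall x y, q y x = (q x y)^*.
Hypothesis q_ge0 : forall x, 0 <= q x x.
Hypothesis A_linear : linear A.
Hypothesis A_selfadjoint : forall x y, q (A x) y = q x (A y).
Hypothesis A_ge0 : forall x, 0 <= q (A x) x.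
Hypothesis M_gt0 : 0 < M.
Hypothesis A_bounded : forall x, seminormq q (A x) <= M * seminormq q x.

Let qA x y := q (A x) y.
Local Notation N := (seminormq q).
Local Notation NA := (seminormq qA).

Lemma qA_linear a x y z : qA (a *: x + y) z = a * qA x z + qA y z.
Proof. by rewrite /qA A_linear q_linear. Qed.

Lemma qA_herm x y : qA y x = (qA x y)^*.
Proof. by rewrite /qA A_selfadjoint q_herm. Qed.

Lemma seminormq_modulus x : N x ^+ 2 = modulus (q x x).
Proof. by rewrite -seminormq_sq // modulus_real ?sqr_ge0. Qed.

Lemma seminormA_sq x : ((NA x ^+ 2)%:C)%C = q (A x) x.
Proof. exact: (@seminormq_sq _ _ qA A_ge0). Qed.

Lemma seminormA_le x : NA x ^+ 2 <= N (A x) * N x.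
Proof.
rewrite -[NA x ^+ 2]modulus_real ?sqr_ge0// seminormA_sq.
exact: cauchy_schwarz.
Qed.

(** Cauchy-Schwarz for [qA] at [w] and [A w] gives [N (A w) ^+ 2 <= NA w * NA (A w)], and
    [NA (A w) ^+ 2 <= M * N (A w) ^+ 2]. Squaring the first and dividing by [N (A w) ^+ 2] leaves
    the claim. *)
Lemma norm_image_le w : N (A w) ^+ 2 <= M * NA w ^+ 2.
Proof.
have [a0|a_gt0] := eqVneq (N (A w)) 0.
  by rewrite a0 expr0n mulr_ge0 ?sqr_ge0// ltW.
have cs : N (A w) ^+ 2 <= NA w * NA (A w).
  rewrite seminormq_modulus -/(qA w (A w)).
  exact: (cauchy_schwarz qA_linear qA_herm (A_ge0 : forall x, 0 <= qA x x)).
have NAA : NA (A w) ^+ 2 <= M * N (A w) ^+ 2.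
  apply: le_trans (seminormA_le _) _.
  by rewrite expr2 mulrA ler_wpM2r ?seminormq_ge0.
have a2 : 0 < N (A w) ^+ 2 by rewrite lt_def expf_neq0// sqr_ge0.
rewrite -(ler_pM2r a2) [M * _ * _]mulrAC.
apply: le_trans (_ : (NA w * NA (A w)) ^+ 2 <= _).
  by rewrite -expr2 ler_pXn2r ?nnegrE ?sqr_ge0 ?mulr_ge0 ?seminormq_ge0.
by rewrite exprMn mulrC ler_wpM2r ?sqr_ge0.
Qed.

(* A gradient step of length [1 / M] for the convex function [w |-> NA w ^ 2]. *)
Lemma gradient_step w (w' := w - (M^-1)%:C%C *: A w) :
  N w' <= N w /\ NA w' ^+ 2 <= NA w ^+ 2 - N (A w) ^+ 2 / M.
Proof.
have w'E : w' = w + (- (M^-1)%:C%C) *: A w by rewrite scaleNr.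
have cJ z : complex.Re ((- (M^-1)%:C%C)^* * ((z%:C)%C : R[i])) = - (z / M).
  have -> : (- (M^-1)%:C%C : R[i])^* = ((- M^-1)%:C)%C.
    by rewrite rmorphN [RHS]rmorphN /=; congr (- _); exact: conjc_real.
  by rewrite -rmorphM /= mulNr mulrC.
have mc : modulus (- (M^-1)%:C%C : R[i]) = M^-1.
  by rewrite (modulus_norm (normrN _)) modulus_real ?invr_ge0 ?ltW.
have im := norm_image_le w.
have imA : NA (A w) ^+ 2 <= M * N (A w) ^+ 2.
  apply: le_trans (seminormA_le _) _.
  by rewrite expr2 mulrA ler_wpM2r ?seminormq_ge0.
have t0 : 0 < M^-1 by rewrite invr_gt0.
have tM : M^-1 * M = 1 by rewrite mulVf ?gt_eqF.
split.
  (* Here [N w' ^+ 2] equals [N w ^+ 2 - 2 NA w ^+ 2 / M + N (A w) ^+ 2 / M ^+ 2], and [im] bounds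
     the last term by [NA w ^+ 2 / M]. *)
  rewrite -(@ler_pXn2r _ 2%N) ?nnegrE ?seminormq_ge0// w'E seminormqE //.
  rewrite -[q w (A w)]A_selfadjoint -seminormA_sq cJ mc.
  have := ler_wpM2l (sqr_ge0 M^-1) im.
  have -> : M^-1 ^+ 2 * (M * NA w ^+ 2) = M^-1 * NA w ^+ 2.
    by rewrite expr2 -mulrA [M^-1 * (M * _)]mulrA tM mul1r.
  have := mulr_ge0 (ltW t0) (sqr_ge0 (NA w)).
  rewrite [_ / M]mulrC; lra.
(* The same expansion for [qA], with cross term [N (A w) ^+ 2] and [imA] bounding the quadratic
   term. *)
rewrite w'E (seminormqE qA_linear qA_herm (A_ge0 : forall x, 0 <= qA x x)).
have -> : qA w (A w) = ((N (A w) ^+ 2)%:C)%C by rewrite (seminormq_sq q_ge0).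
rewrite cJ mc.
have := ler_wpM2l (sqr_ge0 M^-1) imA.
have -> : M^-1 ^+ 2 * (M * N (A w) ^+ 2) = M^-1 * N (A w) ^+ 2.
  by rewrite expr2 -mulrA [M^-1 * (M * _)]mulrA tM mul1r.
rewrite [_ / M]mulrC; lra.
Qed.

(** If every [NA (x - A y)] were at least [e], each gradient step would lower [NA ^+ 2] by a fixed
    amount, and enough steps would make it negative. *)
Lemma range_dense x e : 0 < e -> exists y, NA (x - A y) < e.
Proof.
move=> e0; apply: contrapT => far.
have {}far y : e <= NA (x - A y).
  by rewrite leNgt; apply/negP => close; apply: far; exists y.
(* The guaranteed decrease: [e ^+ 2 <= NA w ^+ 2 <= N (A w) * N w] and [N w <= N x] give
   [N (A w) ^+ 2 / M >= d]. *)
pose d := e ^+ 4 / (M * N x ^+ 2).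
have Nx_gt0 : 0 < N x.
  rewrite lt_def seminormq_ge0 andbT; apply/negP => /eqP x0.
  have := seminormA_le x; rewrite x0 mulr0 => le0.
  have := far 0; rewrite linear_map0 // subr0 => ex.
  have : 0 < NA x ^+ 2 by rewrite exprn_gt0// (lt_le_trans e0).
  lra.
have d_gt0 : 0 < d by rewrite divr_gt0 ?mulr_gt0 ?exprn_gt0.
have descent n : exists y, N (x - A y) <= N x /\
    NA (x - A y) ^+ 2 <= NA x ^+ 2 - n%:R * d.
  elim: n => [|n [y [yN yNA]]].
    by exists 0; rewrite linear_map0 // subr0 mul0r subr0.
  set w := x - A y in yN yNA.
  (* With this witness the new residual is [w - A w / M], one gradient step from [w]. *)
  exists (y + (M^-1)%:C%C *: w).
  rewrite linear_add // linear_scale // opprD addrA -/w.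
  have [stepN stepNA] := gradient_step w.
  split; first exact: le_trans stepN yN.
  apply: le_trans stepNA _.
  suff : d <= N (A w) ^+ 2 / M.
    by rewrite -[n.+1]addn1 natrD mulrDl mul1r; lra.
  have ew : e ^+ 2 <= N (A w) * N x.
    apply: le_trans (_ : NA w ^+ 2 <= _).
      by rewrite ler_pXn2r ?nnegrE ?seminormq_ge0 ?(ltW e0)//; exact: far.
    apply: le_trans (seminormA_le w) _.
    by rewrite ler_wpM2l ?seminormq_ge0.
  rewrite /d invfM mulrA mulrAC ler_pM2r ?invr_gt0// ler_pdivrMr ?exprn_gt0//.
  rewrite -exprMn -[4%N]/(2 * 2)%N exprM.
  by rewrite ler_pXn2r ?nnegrE ?sqr_ge0 ?mulr_ge0 ?seminormq_ge0.
(* More than [NA x ^+ 2 / d] steps exhaust the initial value. *)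
have [y [_]] := descent (Num.truncn (NA x ^+ 2 / d)).+1.
have := truncnS_gt (NA x ^+ 2 / d); rewrite ltr_pdivrMr// => big.
have := sqr_ge0 (NA (x - A y)); lra.
Qed.

End RangeDensity.

(** * Weighted quadratic mean of two reals *)

Section WeightedMean.
Set Implicit Arguments.
Unset Strict Implicit.
Context {R : realType}.
Variable alpha : R.
Hypothesis halpha : 0 <= alpha <= 1.
Implicit Types u v : R.

(** A weighted Euclidean norm on the plane (a semi-norm if [alpha] is 0 or 1). [normAalpha] is the
    supremum of its values at the pairs ([|<Tx, x>_A|], [normA (T x)]). *)
Definition wmean u v : R := Num.sqrt (alpha * u ^+ 2 + (1 - alpha) * v ^+ 2).

Lemma wmean_rad_ge0 u v : 0 <= alpha * u ^+ 2 + (1 - alpha) * v ^+ 2.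
Proof.
have /andP[a0 a1] := halpha.
by rewrite addr_ge0 // mulr_ge0 ?sqr_ge0 ?subr_ge0.
Qed.

Lemma wmean_sq u v : wmean u v ^+ 2 = alpha * u ^+ 2 + (1 - alpha) * v ^+ 2.
Proof. by rewrite sqr_sqrtr ?wmean_rad_ge0. Qed.

Lemma wmean_ge0 u v : 0 <= wmean u v. Proof. exact: sqrtr_ge0. Qed.

Lemma wmean_mono u v u' v' : 0 <= u <= u' -> 0 <= v <= v' ->
  wmean u v <= wmean u' v'.
Proof.
move=> /andP[u0 uu'] /andP[v0 vv']; have /andP[a0 a1] := halpha.
apply: ler_wsqrtr; apply: lerD; apply: ler_wpM2l; rewrite ?subr_ge0//.
  by rewrite ler_pXn2r ?nnegrE// (le_trans u0).
by rewrite ler_pXn2r ?nnegrE// (le_trans v0).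
Qed.

Lemma wmeanZ t u v : 0 <= t -> wmean (t * u) (t * v) = t * wmean u v.
Proof.
move=> t0; rewrite -[X in X * wmean _ _](ger0_norm t0) -sqrtr_sqr.
rewrite -sqrtrM ?sqr_ge0//; congr Num.sqrt; ring.
Qed.

(** Minkowski's inequality; squaring reduces it to Cauchy-Schwarz for the weighted product. *)
Lemma wmeanD u v u' v' : wmean (u + u') (v + v') <= wmean u v + wmean u' v'.
Proof.
have /andP[a0 a1] := halpha.
rewrite -(@ler_pXn2r _ 2%N) ?nnegrE ?addr_ge0 ?wmean_ge0// sqrrD !wmean_sq.
suff : alpha * (u * u') + (1 - alpha) * (v * v') <= wmean u v * wmean u' v'.
  rewrite mulr2n => h; nra.
apply: le_trans (ler_norm _) _.
rewrite -(@ler_pXn2r _ 2%N) ?nnegrE ?mulr_ge0 ?wmean_ge0//.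
rewrite real_normK ?num_real// exprMn !wmean_sq -subr_ge0.
(* Lagrange's identity for the defect in Cauchy-Schwarz. *)
suff -> : (alpha * u ^+ 2 + (1 - alpha) * v ^+ 2) *
    (alpha * u' ^+ 2 + (1 - alpha) * v' ^+ 2) -
    (alpha * (u * u') + (1 - alpha) * (v * v')) ^+ 2
    = alpha * (1 - alpha) * (u * v' - u' * v) ^+ 2.
  by rewrite mulr_ge0 ?sqr_ge0 // mulr_ge0 ?subr_ge0.
by ring.
Qed.

Lemma wmean_diag v : 0 <= v -> wmean v v = v.
Proof.
move=> v0; rewrite /wmean -mulrDl addrC subrK mul1r sqrtr_sqr ger0_norm//.
Qed.

End WeightedMean.

(** * Bounds on suprema that survive the default value 0 *)

Section Suprema.
Context {R : realType}.
Implicit Types (S : set R) (b : R).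

(** The condition [0 <= b] covers the empty set, whose supremum is 0. *)
Lemma sup_le_nonneg S b : 0 <= b -> ubound S b -> sup S <= b.
Proof.
move=> b0 Sb; have [->|S0] := eqVneq S set0; first by rewrite sup0.
by apply: ge_sup => //; apply/set0P.
Qed.

(** A set without a supremum, empty or unbounded above, gets the value 0, so no boundedness has to
    be assumed. *)
Lemma sup_nonneg S : lbound S 0 -> 0 <= sup S.
Proof.
move=> S0; have [[[x Sx] Sub]|/sup_out ->//] := pselect (has_sup S).
exact: le_trans (S0 _ Sx) (ub_le_sup Sub Sx).
Qed.

End Suprema.

(** * The semi-Hilbert space and its operators *)

Section SemiHilbertSpace.
Set Implicit Arguments.
Unset Strict Implicit.
Context {R : realType} {H : completeNormedModType R[i]}.
Variables (dot : {dot H for Num.conj}) (A : H -> H) (alpha : R).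
Hypothesis hdot : dot_induces_norm dot.
Hypothesis hA : positive_operator dot A.
Hypothesis halpha : 0 <= alpha <= 1.
Implicit Types (T S : H -> H).

Local Notation q := (dotA dot A).
Local Notation N := (normA dot A).
Local Notation B := (BAhalf dot A).

Lemma dot_linear a x y z : dot (a *: x + y) z = a * dot x z + dot y z.
Proof. exact: linearPl. Qed.

Lemma dot_herm x y : dot y x = (dot x y)^*.
Proof. by rewrite hermC expr0 mul1r. Qed.

Lemma dot_ge0 x : 0 <= dot x x.
Proof. by rewrite -hdot exprn_ge0. Qed.

Lemma norm_dot x : `|x| = ((seminormq dot x)%:C)%C.
Proof.
apply: (@pexpIrn _ 2%N); rewrite ?nnegrE ?normr_ge0 ?ler0c ?seminormq_ge0//.
by rewrite -rmorphXn /= (seminormq_sq dot_ge0) hdot.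
Qed.

Lemma bounded_operator_real T : bounded_operator T ->
  exists2 M : R, 0 < M & forall x, seminormq dot (T x) <= M * seminormq dot x.
Proof.
move=> [_ [M TM]]; exists (modulus M + 1) => [|x].
  by rewrite ltr_wpDl ?modulus_ge0.
rewrite -lecR rmorphM /= -!norm_dot.
(* [M] is merely complex, but [M * |x|] dominates a norm, so it is real, nonnegative and equal to
   its own modulus. *)
have MxE : `|M * `|x| | = M * `|x|.
  by rewrite ger0_norm// (le_trans _ (TM x)).
apply: le_trans (TM x) _; rewrite -MxE normrM normr_id ler_wpM2r//.
by rewrite rmorphD /= modulusE lerDl ler0c.
Qed.

Lemma A_linear : linear A. Proof. by case: hA => -[]. Qed.

Lemma A_sym x y : dot (A x) y = dot x (A y). Proof. by case: hA. Qed.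

Lemma dotA_linear a x y z : q (a *: x + y) z = a * q x z + q y z.
Proof. by rewrite /dotA A_linear dot_linear. Qed.

Lemma dotA_herm x y : q y x = (q x y)^*.
Proof. by rewrite /dotA A_sym dot_herm. Qed.

Lemma dotA_ge0 x : 0 <= q x x. Proof. by case: hA => _ _ /(_ x). Qed.

Lemma normA_ge0 x : 0 <= N x. Proof. exact: sqrtr_ge0. Qed.

Lemma normAD x y : N (x + y) <= N x + N y.
Proof. exact: (seminormqD dotA_linear dotA_herm dotA_ge0). Qed.

Lemma normAZ a x : N (a *: x) = modulus a * N x.
Proof. exact: (seminormqZ dotA_linear dotA_herm dotA_ge0). Qed.

Lemma normA0 : N 0 = 0.
Proof. by rewrite -[X in N X](scale0r 0) normAZ /modulus normr0 mul0r. Qed.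

Lemma dotA_cauchy_schwarz x y : modulus (q x y) <= N x * N y.
Proof. exact: (cauchy_schwarz dotA_linear dotA_herm dotA_ge0). Qed.

Lemma normA_range_dense x e : 0 < e -> exists y, N (x - A y) < e.
Proof.
case: hA => Abd _ _; have [M M0 AM] := bounded_operator_real Abd.
exact: (range_dense dot_linear dot_herm dot_ge0 A_linear A_sym dotA_ge0 M0 AM).
Qed.

Lemma BAhalf_linear T : B T -> linear T. Proof. by case=> -[]. Qed.

Lemma BAhalf_subspace : is_subspace B.
Proof.
have zlin : linear (0 : H -> H) by move=> a x y; rewrite /= scaler0 addr0.
split=> [|a T S [[Tlin [MT TM]] [cT cT0 TcT]] [[Slin [MS SM]] [cS cS0 ScS]]].
  split; first by split => //; exists 0 => x; rewrite normr0 mul0r.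
  by exists 1 => // x; rewrite -[(0 : H -> H) x]/(0 : H) normA0 mul1r normA_ge0.
split.
  split.
    move=> b x y /=.
    change (a *: T (b *: x + y) + S (b *: x + y) =
      b *: (a *: T x + S x) + (a *: T y + S y)).
    by rewrite Tlin Slin !scalerDr !scalerA [a * b]mulrC addrACA.
  exists (`|a| * MT + MS) => x; apply: le_trans (ler_normD _ _) _.
  rewrite mulrDl; apply: lerD => //.
  by rewrite normrZ -mulrA ler_wpM2l.
exists (modulus a * cT + cS) => [|x].
  by rewrite ltr_wpDl ?mulr_ge0 ?modulus_ge0 ?ltW.
apply: le_trans (normAD _ _) _; rewrite normAZ mulrDl lerD//.
by rewrite -mulrA ler_wpM2l ?modulus_ge0.
Qed.

Lemma BAhalf_scale a T : B T -> B (a *: T).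
Proof.
have [B0 Blin] := BAhalf_subspace.
by move=> BT; rewrite -[a *: T]addr0; apply: Blin.
Qed.

(** * Pointwise comparisons and bounds for the three suprema *)

Local Notation f T x := (wmean alpha (modulus (q (T x) x)) (N (T x))).

Lemma numrange_le T x : N x = 1 -> modulus (q (T x) x) <= N (T x).
Proof. by move=> x1; have := dotA_cauchy_schwarz (T x) x; rewrite x1 mulr1. Qed.

Lemma wmean_le_normA T x : N x = 1 -> f T x <= N (T x).
Proof.
move=> x1; rewrite -[leRHS](wmean_diag alpha (normA_ge0 _)).
by apply: wmean_mono => //; rewrite ?modulus_ge0 ?numrange_le ?normA_ge0 /=.
Qed.

Lemma numrange_le_wmean T x : N x = 1 -> modulus (q (T x) x) <= f T x.
Proof.
move=> x1; rewrite -[leLHS](wmean_diag alpha (modulus_ge0 _)).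
by apply: wmean_mono => //; rewrite ?modulus_ge0 ?numrange_le /=.
Qed.

Lemma numradA_has_ubound T : B T -> has_ubound (numradA_values dot A T).
Proof.
move=> [_ [c _ Tc]]; exists c => _ [x /= x1 <-].
by apply: le_trans (numrange_le T x1) _; have := Tc x; rewrite x1 mulr1.
Qed.

Lemma normAalpha_has_ubound T :
  B T -> has_ubound (normAalpha_values dot A alpha T).
Proof.
move=> [_ [c _ Tc]]; exists c => _ [x /= x1 <-].
by apply: le_trans (wmean_le_normA T x1) _; have := Tc x; rewrite x1 mulr1.
Qed.

Lemma opnormA_has_ubound T : B T -> has_ubound (opnormA_values dot A T).
Proof.
move=> [_ [c c0 Tc]]; exists c => _ [x _ <-].
(* Where [N x = 0] the quotient is 0, because the inverse of 0 is 0. *)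
have := normA_ge0 x; rewrite [0 <= _]le_eqVlt => /predU1P[Nx0|x0].
  by rewrite -Nx0 invr0 mulr0 ltW.
by rewrite ler_pdivrMr.
Qed.

Lemma numradA_ge T x : B T -> N x = 1 -> modulus (q (T x) x) <= numradA dot A T.
Proof.
by move=> BT x1; apply: ub_le_sup; [exact: numradA_has_ubound|exists x].
Qed.

Lemma normAalpha_ge T x : B T -> N x = 1 -> f T x <= normAalpha dot A alpha T.
Proof.
by move=> BT x1; apply: ub_le_sup; [exact: normAalpha_has_ubound|exists x].
Qed.

Lemma numradA_ge0 T : 0 <= numradA dot A T.
Proof. by apply: sup_nonneg => _ [x _ <-]; exact: modulus_ge0. Qed.

Lemma normAalpha_ge0 T : 0 <= normAalpha dot A alpha T.
Proof. by apply: sup_nonneg => _ [x _ <-]; exact: sqrtr_ge0. Qed.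

Lemma opnormA_ge0 T : 0 <= opnormA dot A T.
Proof.
by apply: sup_nonneg => _ [x _ <-]; rewrite divr_ge0 ?normA_ge0.
Qed.

Lemma normAalpha_le T b : 0 <= b -> (forall x, N x = 1 -> f T x <= b) ->
  normAalpha dot A alpha T <= b.
Proof. by move=> b0 Tb; apply: sup_le_nonneg => // _ [x x1 <-]; exact: Tb. Qed.

Lemma numradA_le T b : 0 <= b ->
  (forall x, N x = 1 -> modulus (q (T x) x) <= b) -> numradA dot A T <= b.
Proof. by move=> b0 Tb; apply: sup_le_nonneg => // _ [x x1 <-]; exact: Tb. Qed.

(** Each quotient with [N x > 0] is [N (T u)] for the normalized vector [u], so a bound over all
    unit vectors of [H] is enough. *)
Lemma opnormA_le T b : B T -> 0 <= b ->
  (forall x, N x = 1 -> N (T x) <= b) -> opnormA dot A T <= b.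
Proof.
move=> BT b0 Tb; apply: sup_le_nonneg => // _ [x _ <-].
have := normA_ge0 x; rewrite [0 <= _]le_eqVlt => /predU1P[Nx0|x0].
  by rewrite -Nx0 invr0 mulr0.
have := Tb _ (seminormq_normalize dotA_linear dotA_herm dotA_ge0 x0).
rewrite linear_scale; last exact: BAhalf_linear.
by rewrite normAZ modulus_real ?invr_ge0 ?normA_ge0// mulrC.
Qed.

(* The supremum defining [opnormA] only sees [closure (range A)]; vectors off it
   are reached because [range A] is already [normA]-dense in [H]. *)
Lemma opnormA_ge T x : B T -> N x = 1 -> N (T x) <= opnormA dot A T.
Proof.
move=> BT x1; have Tlin := BAhalf_linear BT.
have [_ [c c0 Tc]] := BT; set L := opnormA dot A T.
have L0 : 0 <= L := opnormA_ge0 T.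
have rangeL y : N (T (A y)) <= L * N (A y).
  have := normA_ge0 (A y); rewrite [0 <= _]le_eqVlt => /predU1P[Ay0|Ay0].
    by have := Tc (A y); rewrite -Ay0 !mulr0.
  rewrite -ler_pdivrMr//; apply: ub_le_sup; first exact: opnormA_has_ubound.
  exists (A y) => //=; split; first by apply: subset_closure; exists y.
  by apply: contraTneq Ay0 => ->; rewrite normA0 ltxx.
apply/ler_addgt0Pr => e e0.
have cL : 0 < c + L by rewrite ltr_pwDl.
(* With [x = A y + z], [N (T x) <= L * N (A y) + c * N z <= L + (c + L) * N z]; the tolerance
   [e / (c + L)] makes this at most [L + e]. *)
have [y yd] := normA_range_dense x (divr_gt0 e0 cL).
set z := x - A y in yd.
have Nz : N (A y) <= 1 + N z.
  have -> : A y = x + (-1) *: z by rewrite scaleN1r /z subKr.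
  apply: le_trans (normAD _ _) _; rewrite normAZ x1.
  by rewrite (modulus_norm (normrN _)) modulus_real// mul1r.
have -> : x = A y + z by rewrite /z addrC subrK.
rewrite linear_add//; apply: le_trans (normAD _ _) _.
apply: le_trans (lerD (rangeL y) (Tc z)) _.
apply: le_trans (lerD (ler_wpM2l L0 Nz) (lexx _)) _.
move: yd; rewrite ltr_pdivlMr// => yd; lra.
Qed.

Lemma normA_le_numradA T x : B T -> N x = 1 -> N (T x) <= 2 * numradA dot A T.
Proof.
move=> BT x1; have Tlin := BAhalf_linear BT; have [_ [c c0 Tc]] := BT.
apply: (numrange_bound dotA_linear dotA_herm dotA_ge0) => // z.
apply: (numrange_homogeneous dotA_linear dotA_herm dotA_ge0 Tlin Tc) => u u1.
exact: numradA_ge.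
Qed.

(** * The semi-norm axioms *)

Lemma normAalpha_scale_le a T : B T ->
  normAalpha dot A alpha (a *: T) <= modulus a * normAalpha dot A alpha T.
Proof.
move=> BT; apply: normAalpha_le.
  by rewrite mulr_ge0 ?modulus_ge0 ?normAalpha_ge0.
move=> x x1; rewrite -[(a *: T) x]/(a *: T x) normAZ (formZl dotA_linear) modulusM.
rewrite wmeanZ ?modulus_ge0// ler_wpM2l ?modulus_ge0//.
exact: normAalpha_ge.
Qed.

Lemma normAalpha_seminorm : is_seminorm_on B (normAalpha dot A alpha).
Proof.
split.
- exact: BAhalf_subspace.
- by move=> T _; exact: normAalpha_ge0.
- move=> a T BT; apply/eqP; rewrite eq_le normAalpha_scale_le//=.
  have [->|a0] := eqVneq a 0.
    by rewrite {1}/modulus normr0 mul0r normAalpha_ge0.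
  (* The reverse inequality is the same bound for the scalar [a^-1] and the operator [a *: T]. *)
  have := normAalpha_scale_le a^-1 (BAhalf_scale a BT).
  rewrite scalerA mulVf// scale1r.
  have ma : modulus a != 0.
    by apply: contra_neq a0 => ma0; apply: normr0_eq0; rewrite -modulusE ma0.
  have -> : modulus a^-1 = (modulus a)^-1.
    apply: (mulIf ma); rewrite -modulusM !mulVf//.
    by apply: complexI; rewrite modulusE normr1.
  by rewrite ler_pdivlMl// lt_def ma modulus_ge0.
- move=> T S BT BS; apply: normAalpha_le.
    by rewrite addr_ge0 ?normAalpha_ge0.
  move=> x x1.
  (* At a fixed unit [x], Minkowski for [wmean] and its monotonicity leave a triangle inequality in
     each argument. *)
  apply: le_trans (lerD (normAalpha_ge BT x1) (normAalpha_ge BS x1)).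
  apply: le_trans (wmeanD halpha _ _ _ _).
  rewrite -[(T + S) x]/(T x + S x) (formDl dotA_linear).
  apply: wmean_mono => //.
    by rewrite modulus_ge0 le_modulusD.
  by rewrite normA_ge0 normAD.
Qed.

(** * The inequalities between the three semi-norms *)

Lemma numradA_le_normAalpha T : B T -> numradA dot A T <= normAalpha dot A alpha T.
Proof.
move=> BT; apply: numradA_le => [|x x1]; first exact: normAalpha_ge0.
exact: le_trans (numrange_le_wmean T x1) (normAalpha_ge BT x1).
Qed.

Lemma normAalpha_le_numradA T : B T ->
  normAalpha dot A alpha T <= Num.sqrt (4 - 3 * alpha) * numradA dot A T.
Proof.
move=> BT; have w0 := numradA_ge0 T; have /andP[a0 a1] := halpha.
apply: normAalpha_le => [|x x1]; first by rewrite mulr_ge0 ?sqrtr_ge0.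
(* The constant is the weighted mean of 1 and 2: [alpha + 4 (1 - alpha) = 4 - 3 alpha]. *)
have -> : Num.sqrt (4 - 3 * alpha) * numradA dot A T
    = wmean alpha (numradA dot A T) (2 * numradA dot A T).
  rewrite -{1}[numradA dot A T]ger0_norm// -sqrtr_sqr -sqrtrM; last lra.
  by congr Num.sqrt; ring.
apply: wmean_mono => //; first by rewrite modulus_ge0 numradA_ge.
by rewrite normA_ge0 normA_le_numradA.
Qed.

Lemma normAalpha_le_opnormA T : B T -> normAalpha dot A alpha T <= opnormA dot A T.
Proof.
move=> BT; apply: normAalpha_le => [|x x1]; first exact: opnormA_ge0.
exact: le_trans (wmean_le_normA T x1) (opnormA_ge BT x1).
Qed.

Lemma opnormA_le_normAalpha T : B T ->
  Num.max (1 / 2) (Num.sqrt (1 - alpha)) * opnormA dot A T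
    <= normAalpha dot A alpha T.
Proof.
move=> BT; have p0 := normAalpha_ge0 T; have /andP[a0 a1] := halpha.
(* The factor 1/2 comes from [N (T x) <= 2 w_A(T)] and [w_A(T) <= normAalpha]. *)
have half : 1 / 2 * opnormA dot A T <= normAalpha dot A alpha T.
  suff : opnormA dot A T <= 2 * normAalpha dot A alpha T by lra.
  apply: opnormA_le => // [|x x1]; first by rewrite mulr_ge0.
  apply: le_trans (normA_le_numradA BT x1) _.
  by rewrite ler_wpM2l// numradA_le_normAalpha.
have root : Num.sqrt (1 - alpha) * opnormA dot A T <= normAalpha dot A alpha T.
  (* The root vanishes at [alpha = 1], so this case is split off before dividing. Otherwise the
     [alpha] term under the square root is dropped. *)
  have [s0|s0] := leP (Num.sqrt (1 - alpha)) 0.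
    by apply: le_trans p0; rewrite mulr_le0_ge0 ?opnormA_ge0.
  rewrite mulrC -ler_pdivlMr//; apply: opnormA_le => // [|x x1].
    by rewrite divr_ge0 ?sqrtr_ge0.
  rewrite ler_pdivlMr//; apply: le_trans (normAalpha_ge BT x1).
  rewrite mulrC -{1}[N (T x)]ger0_norm ?normA_ge0// -sqrtr_sqr -sqrtrM ?subr_ge0//.
  by apply: ler_wsqrtr; rewrite lerDr mulr_ge0 ?sqr_ge0.
by case: (leP (1 / 2) (Num.sqrt (1 - alpha))).
Qed.

End SemiHilbertSpace.

Theorem theorem2p1 (R : realType) (H : completeNormedModType R[i])
    (dot : {dot H for Num.conj}) (hdot : dot_induces_norm dot)
    (A : H -> H) (hA : positive_operator dot A)
    (alpha : R) (halpha : 0 <= alpha <= 1) :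
  [/\ (forall T, BAhalf dot A T ->
         [/\ has_ubound (normAalpha_values dot A alpha T),
             has_ubound (numradA_values dot A T) &
             has_ubound (opnormA_values dot A T)])
      /\ is_seminorm_on (BAhalf dot A) (normAalpha dot A alpha),
      equivalent_on (BAhalf dot A) (normAalpha dot A alpha) (numradA dot A),
      equivalent_on (BAhalf dot A) (normAalpha dot A alpha) (opnormA dot A),
      forall T, BAhalf dot A T ->
        numradA dot A T <= normAalpha dot A alpha T
        /\ normAalpha dot A alpha T
             <= Num.sqrt (4 - 3 * alpha) * numradA dot A T &
      forall T, BAhalf dot A T ->
        Num.max (1 / 2) (Num.sqrt (1 - alpha)) * opnormA dot A T
          <= normAalpha dot A alpha T
        /\ normAalpha dot A alpha T <= opnormA dot A T].
Proof.
have /andP[a0 a1] := halpha.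
have wle := numradA_le_normAalpha hA halpha.
have lew := normAalpha_le_numradA hA halpha.
have ople := opnormA_le_normAalpha hA halpha.
have leop := normAalpha_le_opnormA hdot hA halpha.
split.
- split; last exact: normAalpha_seminorm.
  move=> T BT; split.
  + exact: normAalpha_has_ubound.
  + exact: numradA_has_ubound.
  + exact: opnormA_has_ubound.
- have s0 : 0 < Num.sqrt (4 - 3 * alpha) by rewrite sqrtr_gt0; lra.
  exists (Num.sqrt (4 - 3 * alpha))^-1, 1; split; rewrite ?invr_gt0// => T BT.
  by rewrite mul1r ler_pdivrMl// lew// wle.
(* The 1/2 in the maximum gives the constant 2, uniformly in [alpha]. *)
- exists 1, 2; split => // T BT; rewrite mul1r leop//; split => //.
  have h := ople T BT.
  have op0 := opnormA_ge0 dot A T.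
  have := ler_wpM2r op0 (_ : 1 / 2 <= Num.max (1 / 2) (Num.sqrt (1 - alpha))).
  by rewrite le_max lexx => /(_ isT); lra.
- by move=> T BT; split; [exact: wle|exact: lew].
- by move=> T BT; split; [exact: ople|exact: leop].
Qed.
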